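(* Let $R$ be a finite ring with $1$, let $A$ be a Frobenius bimodule over $R$, and let $w : A \to \mathbb{C}$ be a bi-invariant weight on $A$. Suppose that for every nonzero right submodule $S \subseteq A$, $$\sum_{aR \subseteq S} w(a)\,\mu(0,aR) \neq 0,$$ where the sum is over the cyclic right submodules $aR$ of $A$ contained in $S$, and $\mu$ is the Möbius function of the poset of cyclic right submodules of $A$. Then $w$ has the extension property.
   Context: Rings are associative with $1$, not necessarily commutative. $\mathcal{U}$ denotes the group of units of $R$. $\widehat{R}$ is the group of complex characters $\pi : (R,+) \to \mathbb{C}^\times$; it is an $R$-bimodule via $({}^s\pi)(r) = \pi(rs)$ and $(\pi^s)(r) = \pi(sr)$ for $r,s\in R$. A Frobenius bimodule over $R$ is an $R$-$R$-bimodule $A$ such that ${}_RA \cong {}_R\widehat{R}$ as left modules and $A_R \cong \widehat{R}_R$ as right modules. A weight on $A$ is a function $w : A \to \mathbb{C}$ with $w(0)=0$. It is bi-invariant if $w(uav)=w(a)$ for all $a\in A$ and $u,v\in\mathcal{U}$. Let $P=\{aR : a\in A\}$ be the set of all cyclic right submodules of $A$, partially ordered by inclusion, with Möbius function $\mu$: $\mu(aR,cR)=0$ when $aR\not\subseteq cR$; $\mu(aR,aR)=1$; and $\sum_{aR\subseteq bR\subseteq cR}\mu(aR,bR)=0$ (sum over $bR \in P$) for $aR\subsetneq cR$. It is known that $aR=bR$ if and only if $a\,\mathcal{U}=b\,\mathcal{U}$, so for bi-invariant $w$ the value $w(a)$ depends only on $aR$. The weight is extended to $A^n$ by $w(x)=\sum_{i=1}^n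 w(x_i)$. An ($R$-linear) code of length $n$ over $A$ is a left $R$-submodule $C\subseteq A^n$. A $w$-isometry is an injective left $R$-linear homomorphism $f:C\to A^n$ with $w(f(x))=w(x)$ for all $x\in C$. A monomial transformation of $A^n$ is a map $T:A^n\to A^n$ of the form $T(x_1,\dots,x_n)=(x_{\sigma(1)}u_1,\dots,x_{\sigma(n)}u_n)$ with $u_1,\dots,u_n\in\mathcal{U}$ and $\sigma$ a permutation of $\{1,\dots,n\}$. A bi-invariant weight $w$ on $A$ has the extension property if for every $n$, every linear code $C\subseteq A^n$ and every $w$-isometry $f:C\to A^n$, the map $f$ extends to a monomial transformation of $A^n$. *)

(* Defs.v *)
From HB Require Import structures.
From mathcomp Require Import all_boot all_order all_fingroup all_algebra.
From mathcomp Require Import reals complex.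

Set Implicit Arguments.
Unset Strict Implicit.
Unset Printing Implicit Defensive.

Import GRing.Theory.

Local Open Scope ring_scope.

(* [GRing.unit] is only available for nontrivial rings with a chosen inverse;
   here the zero ring is allowed. *)
Definition is_unit (R : pzRingType) (u : R) : Prop :=
  exists v : R, u * v = 1 /\ v * u = 1.

(* The left action is not given by an [lmodType], because finalg
    has no finite [lmodType] over a possibly zero ring. *)

HB.mixin Record Zmodule_isBimodule (R : pzRingType) (A : Type)
    & GRing.Zmodule A := {
  lscale : R -> A -> A;
  rscale : A -> R -> A;
  lscale1 : forall a, lscale 1 a = a;
  rscale1 : forall a, rscale a 1 = a;
  lscaleA : forall r s a, lscale r (lscale s a) = lscale (r * s) a;
  rscaleA : forall a r s, rscale (rscale a r) s = rscale a (r * s);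
  lscaleDr : forall r, {morph lscale r : a b / a + b};
  lscaleDl : forall a, {morph lscale^~ a : r s / r + s};
  rscaleDl : forall r, {morph rscale^~ r : a b / a + b};
  rscaleDr : forall a, {morph rscale a : r s / r + s};
  lrscaleA : forall r a s, lscale r (rscale a s) = rscale (lscale r a) s
}.

#[short(type="bimodType")]
HB.structure Definition Bimodule (R : pzRingType) :=
  {A of GRing.Zmodule A & Zmodule_isBimodule R A}.

#[short(type="finBimodType")]
HB.structure Definition FinBimodule (R : pzRingType) :=
  {A of Bimodule R A & Finite A}.

Definition left_iso (R : pzRingType) (A B : bimodType R) : Prop :=
  exists phi : A -> B,
    [/\ bijective phi, {morph phi : a b / a + b}
      & forall r, {morph phi : a / lscale r a}].

Definition right_iso (R : pzRingType) (A B : bimodType R) : Prop :=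
  exists phi : A -> B,
    [/\ bijective phi, {morph phi : a b / a + b}
      & forall r, {morph phi : a / rscale a r}].

(* Characters of (R, +) with values in the multiplicative group of F; the
    group law is pointwise multiplication, written additively. *)

Section Characters.
Variables (R : finPzRingType) (F : fieldType).

Definition is_char (p : {ffun R -> F}) : bool :=
  [forall r, p r != 0] && [forall r, forall s, p (r + s) == p r * p s].

Record addchar := AddChar { char_val : {ffun R -> F}; _ : is_char char_val }.

HB.instance Definition _ := [isSub for char_val].
HB.instance Definition _ := [Choice of addchar by <:].

Definition char_fun (p : addchar) : R -> F := char_val p.
Coercion char_fun : addchar >-> Funclass.

Lemma charP (p q : addchar) : p =1 q -> p = q.
Proof.
move=> epq; have e : char_val p = char_val q by apply/ffunP=> r; exact: epq.
exact: val_inj e.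
Qed.

Lemma char_neq0 (p : addchar) r : p r != 0.
Proof. by have /andP[/forallP/(_ r)] := valP p. Qed.

Lemma charD (p : addchar) r s : p (r + s) = p r * p s.
Proof. by have /andP[_ /forallP/(_ r)/forallP/(_ s)/eqP] := valP p. Qed.

Lemma char0 (p : addchar) : p 0 = 1.
Proof. by apply: (mulfI (char_neq0 p 0)); rewrite -charD addr0 mulr1. Qed.

Lemma is_charP (f : R -> F) :
    (forall r, f r != 0) -> (forall r s, f (r + s) = f r * f s) ->
  is_char [ffun r => f r].
Proof.
move=> f0 fD; apply/andP; split; first by apply/forallP=> r; rewrite ffunE.
by apply/forallP=> r; apply/forallP=> s; rewrite !ffunE fD.
Qed.

Definition mk_char f f0 fD : addchar := AddChar (@is_charP f f0 fD).

Lemma mk_charE f f0 fD r : @mk_char f f0 fD r = f r.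
Proof. by rewrite /char_fun /= ffunE. Qed.

Definition char_zero : addchar.
Proof.
apply: (@mk_char (fun=> 1)) => *; [exact: oner_neq0 | by rewrite mulr1].
Defined.

Definition char_opp (p : addchar) : addchar.
Proof.
apply: (@mk_char (fun r => (p r)^-1)) => [r | r s].
  by rewrite invr_eq0 char_neq0.
by rewrite charD invfM.
Defined.

Definition char_add (p q : addchar) : addchar.
Proof.
apply: (@mk_char (fun r => p r * q r)) => [r | r s].
  by rewrite mulf_neq0 ?char_neq0.
by rewrite !charD mulrACA.
Defined.

Definition char_lact (s : R) (p : addchar) : addchar.
Proof.
apply: (@mk_char (fun r => p (r * s))) => [r | r t]; first exact: char_neq0.
by rewrite mulrDl charD.
Defined.

Definition char_ract (p : addchar) (s : R) : addchar.
Proof.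
apply: (@mk_char (fun r => p (s * r))) => [r | r t]; first exact: char_neq0.
by rewrite mulrDr charD.
Defined.

Lemma char_addA : associative char_add.
Proof. by move=> p q t; apply/charP=> r; rewrite !mk_charE mulrA. Qed.
Lemma char_addC : commutative char_add.
Proof. by move=> p q; apply/charP=> r; rewrite !mk_charE mulrC. Qed.
Lemma char_add0 : left_id char_zero char_add.
Proof. by move=> p; apply/charP=> r; rewrite !mk_charE mul1r. Qed.
Lemma char_addN : left_inverse char_zero char_opp char_add.
Proof. by move=> p; apply/charP=> r; rewrite !mk_charE mulVf ?char_neq0. Qed.

HB.instance Definition _ :=
  GRing.isZmodule.Build addchar char_addA char_addC char_add0 char_addN.

Lemma char_lactA s t p : char_lact s (char_lact t p) = char_lact (s * t) p.
Proof. by apply/charP=> r; rewrite !mk_charE mulrA. Qed.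
Lemma char_lact1 : left_id 1 char_lact.
Proof. by move=> p; apply/charP=> r; rewrite !mk_charE mulr1. Qed.
Lemma char_lactDr s : {morph char_lact s : p q / p + q}.
Proof. by move=> p q; apply/charP=> r; rewrite !mk_charE. Qed.
Lemma char_lactDl p : {morph char_lact^~ p : s t / s + t}.
Proof. by move=> s t; apply/charP=> r; rewrite !mk_charE mulrDr charD. Qed.

Lemma char_ract1 p : char_ract p 1 = p.
Proof. by apply/charP=> r; rewrite !mk_charE mul1r. Qed.
Lemma char_ractA p s t : char_ract (char_ract p s) t = char_ract p (s * t).
Proof. by apply/charP=> r; rewrite !mk_charE mulrA. Qed.
Lemma char_ractDl s : {morph char_ract^~ s : p q / p + q}.
Proof. by move=> p q; apply/charP=> r; rewrite !mk_charE. Qed.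
Lemma char_ractDr p : {morph char_ract p : s t / s + t}.
Proof. by move=> s t; apply/charP=> r; rewrite !mk_charE mulrDl charD. Qed.
Lemma char_lract s p t :
  char_lact s (char_ract p t) = char_ract (char_lact s p) t.
Proof. by apply/charP=> r; rewrite !mk_charE mulrA. Qed.

HB.instance Definition _ := Zmodule_isBimodule.Build R addchar
  char_lact1 char_ract1 char_lactA char_ractA char_lactDr char_lactDl
  char_ractDl char_ractDr char_lract.

Lemma char_lscaleE s (p : addchar) r : (lscale s p : addchar) r = p (r * s).
Proof. exact: mk_charE. Qed.

Lemma char_rscaleE s (p : addchar) r : (rscale p s : addchar) r = p (s * r).
Proof. exact: mk_charE. Qed.

End Characters.

Definition frobenius_bimodule (K : realType) (R : finPzRingType)
    (A : bimodType R) : Prop :=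
  left_iso A (addchar R K[i]) /\ right_iso A (addchar R K[i]).

(* Moebius function of a finite family P of sets ordered by inclusion. The
    recursion is on the number n of allowed steps, #|Y| being enough; see
    [moebius_nsub], [moebius_refl] and [moebius_sum]. *)

Section Moebius.
Variables (T : finType) (P : {set {set T}}).
Implicit Types X Y Z : {set T}.

Fixpoint moebius_rec (n : nat) (X Y : {set T}) : int :=
  if ~~ (X \subset Y) then 0
  else if X == Y then 1
  else if n is m.+1 then
    - \sum_(Z in P | (X \subset Z) && (Z \proper Y)) moebius_rec m X Z
  else 0.

Definition moebius (X Y : {set T}) : int := moebius_rec #|Y| X Y.

Lemma moebius_rec_stable n m X Y : (#|Y| <= n)%N -> (#|Y| <= m)%N ->
  moebius_rec n X Y = moebius_rec m X Y.
Proof.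
have empty k : moebius_rec k X set0 = moebius_rec 0 X set0.
  by case: k => //= k; rewrite subset0; case: eqP.
elim: n m Y => [|n IH] m Y.
  by rewrite leqn0 cards_eq0 => /eqP-> _; rewrite !empty.
case: m => [_|m leYn leYm].
  by rewrite leqn0 cards_eq0 => /eqP->; rewrite !empty.
rewrite /=; do 2!case: ifP => // _.
congr (- _); apply: eq_bigr => Z /and3P[_ _ /proper_card ltZY].
by apply: IH; rewrite -ltnS; apply: leq_trans ltZY _.
Qed.

Lemma moebius_recE n X Y : (#|Y| <= n)%N -> moebius_rec n X Y = moebius X Y.
Proof. by move=> leYn; apply: moebius_rec_stable. Qed.

Lemma moebius_nsub X Y : ~~ (X \subset Y) -> moebius X Y = 0.
Proof. by rewrite /moebius; case: #|Y| => [|n] /= ->. Qed.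

Lemma moebius_refl X : moebius X X = 1.
Proof. by rewrite /moebius; case: #|X| => [|n] /=; rewrite subxx eqxx. Qed.

Lemma moebius_sum X Y : Y \in P -> X \proper Y ->
  \sum_(Z in P | (X \subset Z) && (Z \subset Y)) moebius X Z = 0.
Proof.
move=> PY ltXY; have sXY := proper_sub ltXY.
rewrite (bigD1 Y) /=; last by rewrite PY sXY subxx.
rewrite {1}/moebius; case EY: #|Y| => [|n] /=.
  by have := proper_card ltXY; rewrite EY.
rewrite sXY /= (negPf (proper_neq ltXY)) addrC; apply/eqP; rewrite subr_eq0.
apply/eqP/eq_big => [Z | Z /andP[/and3P[_ _ sZY] neqZY]].
  by rewrite properEneq -!andbA; congr (_ && (_ && _)); rewrite andbC.
rewrite moebius_recE //.
by rewrite -ltnS -EY proper_card // properEneq neqZY.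
Qed.

End Moebius.

Section Cyclic.
Variables (R : finPzRingType) (A : finBimodType R).

Definition rcyclic (a : A) : {set A} := [set rscale a r | r : R].

Definition rcyclics : {set {set A}} := [set rcyclic a | a : A].

Definition right_submodule (S : {set A}) : Prop :=
  [/\ 0 \in S, {in S &, forall a b, a + b \in S}
    & forall r, {in S, forall a, rscale a r \in S}].

End Cyclic.

Section Weights.
Variables (R : finPzRingType) (A : finBimodType R) (C : nmodType).
Variable w : A -> C.

Definition is_weight : Prop := w 0 = 0.

Definition bi_invariant : Prop :=
  forall (u v : R) (a : A), is_unit u -> is_unit v ->
    w (rscale (lscale u a) v) = w a.

(* The weight of a cyclic right submodule is that of a generator. For a
   bi-invariant w the choice of the generator does not matter, because
   generators of the same cyclic right submodule differ by a unit of R. *)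
Definition cyclic_weight (X : {set A}) : C :=
  if [pick a | rcyclic a == X] is Some a then w a else 0.

Definition wt n (x : {ffun 'I_n -> A}) : C := \sum_(i < n) w (x i).

Definition lscale_vec n (r : R) (x : {ffun 'I_n -> A}) : {ffun 'I_n -> A} :=
  [ffun i => lscale r (x i)].

Definition is_code n (code : {set {ffun 'I_n -> A}}) : Prop :=
  [/\ 0 \in code, {in code &, forall x y, x + y \in code}
    & forall r, {in code, forall x, lscale_vec r x \in code}].

(* A homomorphism from a code to A^n is represented by a function on the whole
   of A^n, only its values on the code being relevant. *)
Definition is_isometry n (code : {set {ffun 'I_n -> A}})
    (f : {ffun 'I_n -> A} -> {ffun 'I_n -> A}) : Prop :=
  [/\ {in code &, injective f},
      {in code &, {morph f : x y / x + y}},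
      forall r : R, {in code, {morph f : x / lscale_vec r x}}
    & {in code, forall x, wt (f x) = wt x}].

Definition is_monomial n (T : {ffun 'I_n -> A} -> {ffun 'I_n -> A}) : Prop :=
  exists (s : 'S_n) (u : 'I_n -> R),
    (forall i, is_unit (u i)) /\
    (forall x, T x = [ffun i => rscale (x (s i)) (u i)]).

Definition extension_property : Prop :=
  forall (n : nat) (code : {set {ffun 'I_n -> A}}),
    is_code code ->
    forall f, is_isometry code f ->
    exists2 T, is_monomial T & {in code, f =1 T}.

End Weights.

(* Main.v *)
From HB Require Import structures.
Require Import Defs.
From mathcomp Require Import all_boot all_order all_fingroup all_algebra.
From mathcomp Require Import reals complex.
From mathcomp Require Import separable cyclotomic.

(** Fourier analysis on A with respect to one character.

    The right isomorphism from A to the character group of R, followed by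
    evaluation at 1, is a character chi of A such that a |-> chi (a _) is
    injective. Orthogonality of characters and the faithfulness of A as a left
    module show that the characters chi (_ s) and the characters chi (r _) are
    the same ones, namely all characters of A ([gen_swap]), so that chi is
    nontrivial on the nonzero left submodules too.

    Summing chi over the generators of X gives a function of the cyclic right
    submodule X whose sums over the X inside a nonzero submodule vanish; the
    Moebius function mu(0, X) is determined by this property on cyclic
    submodules, hence equals that sum ([moebius_gen]). The hypothesis therefore
    says that the sum of w(a) chi(a) over S is nonzero for every nonzero right
    submodule S.

    Let f be a w-isometry, let x be a codeword and y = f(x). Since f is left
    linear, w(qx) = w(qy) for all q in R. Put d(t) for the difference between
    the sums of chi(x_i u t) and of chi(y_i u t) over all i and all units u.
    Expanding w in characters with coefficients c turns the equations
    w(qx) = w(qy) into: the sum over s of c(s) d(st) is 0, for every t in R.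
    Both c and d are invariant under left multiplication by units, and d(0) = 0.
    Ordered by inclusion of the left ideals Rt, this linear system is
    triangular, because Rs = Rt makes s a unit multiple of t
    ([left_associates]). Its diagonal coefficient at t is, up to a positive
    integer, the sum of c(s) over the s with st = t; by orthogonality this is a
    positive multiple of the sum of w(a) chi(a) over the right submodule S of
    all a with chi(as) = 1 whenever st = 0 ([sum_wcoef_neq0]). So it is nonzero
    for t <> 0, and d = 0 ([eq_orbit_char]).

    The case t = 1 of d = 0, for all codewords, is an identity between sums of
    characters of the code. Orthogonality on the code then shows that each left
    linear map into A is as often of the form (i-th coordinate) u as of the form
    (i-th coordinate of f) u. Up to units, the coordinates of f are therefore a
    permutation of those of the identity ([orbits_perm]): this is a monomial
    transformation. *)

Set Implicit Arguments.
Unset Strict Implicit.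
Unset Printing Implicit Defensive.

Import GRing.Theory Num.Theory.

Local Open Scope ring_scope.

(** * Units of a finite ring and generators of cyclic modules *)

Section Units.
Variable R : finPzRingType.
Implicit Types r s t u v : R.

Definition runits : {set R} := [set u | [exists v, (u * v == 1) && (v * u == 1)]].

Lemma runitsP u : reflect (is_unit u) (u \in runits).
Proof.
rewrite inE; apply: (iffP existsP) => [[v /andP[/eqP uv /eqP vu]] | [v [uv vu]]].
  by exists v.
by exists v; rewrite uv vu !eqxx.
Qed.

Lemma runits1 : 1 \in runits.
Proof. by apply/runitsP; exists 1; rewrite mulr1. Qed.

Lemma runitsN1 : -1 \in runits.
Proof. by apply/runitsP; exists (-1); rewrite mulrNN mulr1. Qed.

Lemma runitsM u v : u \in runits -> v \in runits -> u * v \in runits.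
Proof.
move=> /runitsP[u' [uu' u'u]] /runitsP[v' [vv' v'v]]; apply/runitsP.
exists (v' * u'); split.
  by rewrite mulrA -(mulrA u) vv' mulr1.
by rewrite mulrA -(mulrA v') u'u mulr1.
Qed.

Lemma runitsV u : u \in runits ->
  exists2 v, v \in runits & u * v = 1 /\ v * u = 1.
Proof.
move=> /runitsP[v [uv vu]]; exists v => //.
by apply/runitsP; exists u.
Qed.

Lemma runit_injl u : u \in runits -> injective ( *%R u).
Proof.
by move=> /runitsV[v _ [_ vu]] r s e; rewrite -[r]mul1r -[s]mul1r -vu -!mulrA e.
Qed.

Lemma runit_injr u : u \in runits -> injective ( *%R^~ u).
Proof.
by move=> /runitsV[v _ [uv _]] r s /= e; rewrite -[r]mulr1 -[s]mulr1 -uv !mulrA e.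
Qed.

Lemma sum_runitsMl (M : nmodType) (u : R) (F : R -> M) : u \in runits ->
  \sum_(v in runits) F (u * v) = \sum_(v in runits) F v.
Proof.
move=> Uu; rewrite [RHS](reindex_inj (runit_injl Uu)) /=.
apply: eq_bigl => v; apply/idP/idP => [|Uuv]; first exact: runitsM.
have [u' Uu' [_ u'u]] := runitsV Uu.
by rewrite -[v]mul1r -u'u -mulrA runitsM.
Qed.

Lemma sum_runitsMr (M : nmodType) (u : R) (F : R -> M) : u \in runits ->
  \sum_(v in runits) F (v * u) = \sum_(v in runits) F v.
Proof.
move=> Uu; rewrite [RHS](reindex_inj (runit_injr Uu)) /=.
apply: eq_bigl => v; apply/idP/idP => [Uv|Uuv]; first exact: runitsM.
have [u' Uu' [uu' _]] := runitsV Uu.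
by rewrite -[v]mulr1 -uu' mulrA runitsM.
Qed.

(** In a finite ring left multiplication by v is surjective once it is
    injective. *)
Lemma right_inv_unit u v : u * v = 1 -> u \in runits.
Proof.
move=> uv; have injv : injective ( *%R v).
  by move=> r s e; rewrite -[r]mul1r -[s]mul1r -uv -!mulrA e.
have [g gK Kg] := injF_bij injv.
have vu : v * u = 1.
  have vg : v * g 1 = 1 := Kg 1.
  by rewrite -[u]mulr1 -{1}vg (mulrA u) uv mul1r.
by apply/runitsP; exists v.
Qed.

Definition right_ideal (J : {set R}) :=
  [/\ 0 \in J, {in J &, forall r s, r + s \in J}
    & forall s, {in J, forall r, r * s \in J}].

Lemma ridealB J r s : right_ideal J -> r \in J -> s \in J -> r - s \in J.
Proof. by case=> _ JD JM Jr Js; rewrite JD // -mulrN1 JM. Qed.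

Definition pideal (r : R) : {set R} := [set r * s | s : R].

Lemma mem_pideal r : r \in pideal r.
Proof. by apply/imsetP; exists 1; rewrite ?mulr1. Qed.

Lemma pideal_ideal r : right_ideal (pideal r).
Proof.
split; first by apply/imsetP; exists 0; rewrite ?mulr0.
  by move=> _ _ /imsetP[s _ ->] /imsetP[t _ ->]; rewrite -mulrDr imset_f.
by move=> t _ /imsetP[s _ ->]; rewrite -mulrA imset_f.
Qed.

Lemma pideal_sub I r : right_ideal I -> (pideal r \subset I) = (r \in I).
Proof.
case=> _ _ IM; apply/subsetP/idP => [|Ir x /imsetP[s _ ->]]; last exact: IM.
by apply; exact: mem_pideal.
Qed.

(** Gaschuetz' counting argument: the number of units in a coset t + J of a
    right ideal J is the same for all t that generate R modulo J. As 1 + J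
    contains a unit, so does every such coset. *)
Section Gaschutz.
Variable J : {set R}.
Hypothesis idJ : right_ideal J.

(** With I = R these are the units in t + J; the other I serve the induction. *)
Definition coset_gens (t : R) (I : {set R}) : {set R} :=
  [set x | (x - t \in J) && (pideal x == I)].

Definition generates (t : R) := exists s, 1 - t * s \in J.

(** When t generates R modulo J, the ideal I meets t + J if and only if
    I + J = R, and then in a coset of the intersection of I and J; neither
    depends on t. *)
Lemma coset_in_ideal (I : {set R}) t : right_ideal I -> generates t ->
  #|[set x | (x - t \in J) && (x \in I)]|
    = if [exists x in I, 1 - x \in J] then #|I :&: J| else 0%N.
Proof.
move=> idI [s Jts]; have [_ ID IM] := idI; have [_ JD JM] := idJ.
(* If y in I is 1 modulo J, then y * t is an element of I in the coset t + J. *)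
case: ifPn => [/existsP[y /andP[Iy Jy]] | nI].
  have -> : [set x | (x - t \in J) && (x \in I)]
              = [set y * t + z | z in I :&: J].
    apply/setP=> x; rewrite inE; apply/idP/imsetP.
      move=> /andP[Jx Ix]; exists (x - y * t); last by rewrite addrC subrK.
      rewrite inE ridealB ?IM //=.
      have -> : x - y * t = (x - t) + (1 - y) * t.
        by rewrite mulrBl mul1r addrA subrK.
      by rewrite JD ?JM.
    case=> z /setIP[Iz Jz] ->; rewrite ID ?IM // andbT.
    have -> : y * t + z - t = z - (1 - y) * t.
      by rewrite mulrBl mul1r opprB addrAC addrC.
    by rewrite ridealB // JM.
  by rewrite card_imset //; exact: addrI.
apply/eqP; rewrite cards_eq0; apply/eqP/setP=> x; rewrite !inE.
apply: contraNF nI => /andP[Jx Ix]; apply/existsP; exists (x * s).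
rewrite IM //=.
have -> : 1 - x * s = (1 - t * s) - (x - t) * s.
  by rewrite mulrBl opprB addrA subrK.
by rewrite ridealB // JM.
Qed.

Lemma coset_in_ideal_sum (I : {set R}) t : right_ideal I ->
  #|[set x | (x - t \in J) && (x \in I)]|
    = (\sum_(I' : {set R} | I' \subset I) #|coset_gens t I'|)%N.
Proof.
move=> idI; rewrite -sum1_card.
rewrite (partition_big pideal (fun I' => I' \subset I)) /=; last first.
  by move=> x; rewrite inE => /andP[_]; rewrite pideal_sub.
apply: eq_bigr => I' sI'; rewrite -sum1_card; apply: eq_bigl => x.
rewrite !inE -andbA; case: (_ \in J) => //=.
case: eqP => [eI|]; last by rewrite andbF.
by rewrite andbT -pideal_sub // eI.
Qed.

(** Moebius inversion, done as an induction on I: [coset_in_ideal_sum] expresses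
    a number independent of t as the sum of [coset_gens] over the ideals
    inside I. *)
Lemma coset_gens_card t t' (I : {set R}) : generates t -> generates t' ->
  #|coset_gens t I| = #|coset_gens t' I|.
Proof.
move=> gt gt'; have [n] := ubnP #|I|; elim: n I => // n IHn I leIn.
have [/existsP[y /eqP eI] | nI] := boolP [exists y, I == pideal y]; last first.
  suff e t0 : coset_gens t0 I = set0 by rewrite !e.
  apply/setP=> x; rewrite !inE; apply/negP=> /andP[_ /eqP eI].
  by case/negP: nI; apply/existsP; exists x; rewrite eI.
have idI : right_ideal I by rewrite eI; exact: pideal_ideal.
have: #|[set x | (x - t \in J) && (x \in I)]|
        = #|[set x | (x - t' \in J) && (x \in I)]|.
  by rewrite !coset_in_ideal.
rewrite !coset_in_ideal_sum // (bigD1 I) //= [RHS](bigD1 I) //=.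
rewrite (eq_bigr (fun I' => #|coset_gens t' I'|)) => [/addIn //|I' /andP[sI neI]].
apply: IHn; rewrite -ltnS; apply: leq_trans leIn; rewrite ltnS.
by apply: proper_card; rewrite properEneq neI.
Qed.

Lemma gaschutz t s : 1 - t * s \in J -> exists2 u, u \in runits & u - t \in J.
Proof.
move=> Jts.
have gt : generates t by exists s.
have g1 : generates 1 by exists 1; rewrite mulr1 subrr; case: idJ.
have : (0 < #|coset_gens t (pideal (1 : R)%R)|)%N.
  rewrite (coset_gens_card _ gt g1); apply/card_gt0P; exists 1.
  by rewrite inE subrr eqxx andbT; case: idJ.
case/card_gt0P=> u; rewrite inE => /andP[Ju /eqP eu]; exists u => //.
have := mem_pideal (1 : R); rewrite -eu => /imsetP[v _ e].
by apply: (@right_inv_unit u v); rewrite -e.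
Qed.

End Gaschutz.
End Units.

(** Left ideals of R are the right ideals of its converse R^c, which is again a
    finite ring. *)
HB.instance Definition _ (R : finPzRingType) := Finite.on R^c.

(** The coset of s modulo the left annihilator of r contains a unit by
    [gaschutz] in R^c. *)
Lemma left_associates (R : finPzRingType) (r r' s t : R) :
  t = s * r -> r = r' * t -> exists2 u, u \in runits R & t = u * r.
Proof.
move=> et er.
pose J : {set R} := [set x | x * r == 0].
have idJ : @right_ideal (R^c : finPzRingType) J.
  split=> [|x y|y x]; first by rewrite inE mul0r.
    rewrite !(in_set (fun x : R => x * r == 0)) => /eqP ex /eqP ey.
    by rewrite mulrDl ex ey addr0.
  rewrite !(in_set (fun x : R => x * r == 0)) => /eqP ex.
  by change ((y : R) * (x : R) * r == 0); rewrite -mulrA ex mulr0.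
have [|u Uu] := @gaschutz (R^c : finPzRingType) J idJ s r'.
  by rewrite inE mulrBl mul1r -mulrA -et -er subrr.
rewrite inE mulrBl subr_eq0 -et => /eqP eu; exists u => //.
case/runitsP: Uu => v [uv vu]; apply/runitsP; exists v; split; [exact: vu|exact: uv].
Qed.

(** * Characters of the additive group of a finite ring *)

Lemma mulrn_eq0_exists (V : finZmodType) (x : V) :
  exists2 k, (0 < k)%N & x *+ k = 0.
Proof.
by exists #[x]%g; rewrite ?order_gt0 // -FinRing.zmodXgE expg_order.
Qed.

Section Separation.
Variables (R : finPzRingType) (F : numClosedFieldType).

(** The minimal polynomial divides X^k - 1, which has distinct roots. *)
Lemma unity_root_diagonalizable n' (M : 'M[F]_n'.+1) k : (0 < k)%N ->
  M ^+ k = 1 -> diagonalizable M.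
Proof.
move=> k_gt0 Mk; apply/diagonalizableP.
have [rs Drs] := closed_field_poly_normal ('X^k - 1 : {poly F}).
have k0 : k%:R != 0 :> F by rewrite pnatr_eq0 -lt0n.
have := separable_Xn_sub_1 k0.
rewrite Drs (monicP (monicXnsubC _ k_gt0)) scale1r separable_prod_XsubC => Urs.
exists rs => //; apply: mxminpoly_min.
have -> : \prod_(z <- rs) ('X - z%:P) = 'X^k - 1.
  by rewrite Drs (monicP (monicXnsubC _ k_gt0)) scale1r.
by rewrite rmorphB rmorph1 rmorphXn /= horner_mx_X Mk subrr.
Qed.

(** The regular representation of (R, +): the translations of R commute and have
    finite order, so their matrices are simultaneously diagonalizable, and each
    diagonal entry is a character of R. A character nontrivial at r exists
    because a translation by r <> 0 is not the identity. The hypotheses fix an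
    enumeration of R. *)
Section Regular.
Variables (n' : nat) (f : 'I_n'.+1 -> R) (g : R -> 'I_n'.+1).
Hypotheses (fK : cancel f g) (gK : cancel g f).

Definition transl_mx (r : R) : 'M[F]_n'.+1 :=
  \matrix_(i, j) (f j == f i + r)%:R.

Lemma transl_mxD r s : transl_mx (r + s) = transl_mx r * transl_mx s.
Proof.
apply/matrixP=> i j; rewrite !mxE (bigD1 (g (f i + r))) //= !mxE gK eqxx mul1r.
rewrite addrA big1 ?addr0 // => k nek; rewrite !mxE.
case: eqP => [e|]; last by rewrite mul0r.
by rewrite -e fK eqxx in nek.
Qed.

Lemma transl_mx0 : transl_mx 0 = 1.
Proof.
apply/matrixP=> i j; rewrite !mxE addr0 (inj_eq (can_inj fK)).
by rewrite eq_sym.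
Qed.

Lemma transl_mxX r k : transl_mx (r *+ k) = transl_mx r ^+ k.
Proof.
by elim: k => [|k IH]; rewrite ?transl_mx0 // mulrS transl_mxD IH exprS.
Qed.

Lemma transl_mx_inj : injective transl_mx.
Proof.
move=> r s /matrixP/(_ (g 0) (g r)); rewrite !mxE !gK !add0r eqxx.
by case: eqP => // _ /eqP; rewrite oner_eq0.
Qed.

Lemma transl_mx_codiag :
  exists2 P, P \in unitmx & forall r, diagonalizable_for P (transl_mx r).
Proof.
have [] := (codiagonalizableP [seq transl_mx r | r : R]).1.
  split.
    move=> _ _ /mapP[r _ ->] /mapP[s _ ->]; rewrite /comm_mx.
    have mE x y : transl_mx x *m transl_mx y = transl_mx (x + y).
      by rewrite transl_mxD.
    by rewrite !mE addrC.
  move=> _ /mapP[r _ ->].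
  have [k k_gt0 rk] := @mulrn_eq0_exists R r.
  apply: (@unity_root_diagonalizable _ _ k) => //.
  rewrite -transl_mxX rk.
  exact: transl_mx0.
move=> P Pu /allP AP; exists P => // r; apply: AP.
by apply: map_f; rewrite mem_enum.
Qed.

Lemma addchar_sep_aux r : r != 0 -> exists p : addchar R F, p r != 1.
Proof.
move=> r0; have [P Pu PD] := transl_mx_codiag.
pose D s := conjmx P (transl_mx s).
have DD x y : D (x + y) = D x *m D y.
  rewrite /D transl_mxD -[_ * _]/(_ *m _) conjmxM //;
  by rewrite inE stablemx_unit.
have D0 : D 0 = 1%:M by rewrite /D transl_mx0 conjmx_scalar ?row_free_unit.
have Dd x : is_diag_mx (D x) by exact: PD.
have Dii i x y : D (x + y) i i = D x i i * D y i i.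
  rewrite DD mxE (bigD1 i) //= big1 ?addr0 // => j ne.
  by have /is_diag_mxP/(_ i j) -> := Dd x; rewrite ?mul0r // eq_sym.
have Di0 i x : D x i i != 0.
  apply/eqP=> e; have := Dii i x (- x).
  by rewrite subrr D0 e mul0r mxE eqxx => /eqP; rewrite oner_eq0.
case: (pickP (fun i => D r i i != 1)) => [i ne | all1].
  exists (mk_char (Di0 i) (Dii i)).
  by rewrite mk_charE.
case/eqP: r0; apply: transl_mx_inj.
have : D r = D 0.
  apply/matrixP=> i j; rewrite D0 [RHS]mxE; have [<-|ne] := eqVneq i j.
    by rewrite (eqP (negbFE (all1 i))).
  by have /is_diag_mxP-> := Dd r.
by rewrite /D => /(congr1 (conjmx (invmx P))); rewrite !conjmxK.
Qed.

End Regular.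

Lemma addchar_sep (r : R) : r != 0 -> exists p : addchar R F, p r != 1.
Proof.
have e : #|R| = #|R|.-1.+1 by rewrite prednK //; apply/card_gt0P; exists 0.
apply: (@addchar_sep_aux _ (fun i => enum_val (cast_ord (esym e) i))
  (fun x => cast_ord e (enum_rank x))) => x.
  by rewrite enum_valK cast_ordKV.
by rewrite cast_ordK enum_rankK.
Qed.

End Separation.

(** * The generating character of a Frobenius bimodule *)

Section BimoduleTheory.
Variables (R : pzRingType) (A : bimodType R).
Implicit Types (a b : A) (r s : R).

Lemma lscaler0 r : lscale r (0 : A) = 0.
Proof. by apply: (addrI (lscale r 0)); rewrite -lscaleDr !addr0. Qed.

Lemma rscale0r r : rscale (0 : A) r = 0.
Proof. by apply: (addrI (rscale 0 r)); rewrite -rscaleDl !addr0. Qed.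

Lemma rscaler0 a : rscale a 0 = 0.
Proof. by apply: (addrI (rscale a 0)); rewrite -rscaleDr !addr0. Qed.

Lemma lscalerN r a : lscale r (- a) = - lscale r a.
Proof. by apply: (addrI (lscale r a)); rewrite -lscaleDr !subrr lscaler0. Qed.

Lemma rscalerN a r : rscale a (- r) = - rscale a r.
Proof. by apply: (addrI (rscale a r)); rewrite -rscaleDr !subrr rscaler0. Qed.

Lemma rscaleNr a r : rscale (- a) r = - rscale a r.
Proof. by apply: (addrI (rscale a r)); rewrite -rscaleDl !subrr rscale0r. Qed.

End BimoduleTheory.

Lemma rscale_unit_inj (R : finPzRingType) (A : bimodType R) (u : R) :
  u \in runits R -> injective (fun a : A => rscale a u).
Proof.
by move=> /runitsV[v _ [uv _]] a b e; rewrite -[a]rscale1 -[b]rscale1 -uv -!rscaleA e.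
Qed.

(** The coset of t modulo the right annihilator of a contains a unit by
    [gaschutz], when b = a t and a = b s. *)
Lemma right_associates (R : finPzRingType) (A : finBimodType R) (a b : A) :
  rcyclic a = rcyclic b -> exists2 u, u \in runits R & b = rscale a u.
Proof.
move=> e.
have /imsetP[t _ eb] : b \in rcyclic a.
  by rewrite e; apply/imsetP; exists 1; rewrite ?rscale1.
have /imsetP[s _ ea] : a \in rcyclic b.
  by rewrite -e; apply/imsetP; exists 1; rewrite ?rscale1.
pose J : {set R} := [set r | rscale a r == 0].
have idJ : right_ideal J.
  split=> [|x y|y x]; rewrite ?inE ?rscaler0 //.
    by move=> /eqP ex /eqP ey; rewrite rscaleDr ex ey addr0.
  by move=> /eqP ex; rewrite -rscaleA ex rscale0r.
have [|u Uu] := gaschutz idJ (t := t) (s := s).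
  by rewrite inE rscaleDr rscalerN -rscaleA -eb -ea rscale1 subrr.
rewrite inE rscaleDr rscalerN -eb subr_eq0 => /eqP eu.
by exists u.
Qed.

(** The vanishing of nontrivial character sums, with the translation by an
    element on which the character is nontrivial abstracted to tau. *)
Lemma sum_twisted_eq0 (F : fieldType) (T : finType) (H : {set T})
    (phi : T -> F) (tau : T -> T) (c : F) :
  {in H &, injective tau} -> {in H, forall x, tau x \in H} ->
  {in H, forall x, phi (tau x) = c * phi x} -> c != 1 ->
  \sum_(x in H) phi x = 0.
Proof.
move=> inj stab twist c1.
have eH : tau @: H = H.
  apply/eqP; rewrite eqEcard card_in_imset // leqnn andbT.
  by apply/subsetP=> _ /imsetP[x Hx ->]; exact: stab.
have : \sum_(x in H) phi x = c * \sum_(x in H) phi x.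
  by rewrite -{1}eH big_imset //= (eq_bigr _ twist) mulr_sumr.
move/eqP; rewrite -subr_eq0 -{1}[\sum_(_ in _) _]mul1r -mulrBl mulf_eq0.
by rewrite subr_eq0 eq_sym (negPf c1) => /eqP.
Qed.

Lemma sumT_twisted_eq0 (F : fieldType) (T : finType)
    (phi : T -> F) (tau : T -> T) (c : F) :
  injective tau -> (forall x, phi (tau x) = c * phi x) -> c != 1 ->
  \sum_x phi x = 0.
Proof.
move=> inj twist c1.
have <- : \sum_(x in [set: T]) phi x = \sum_x phi x.
  by apply: eq_bigl => x; rewrite inE.
apply: (sum_twisted_eq0 (tau := tau)) c1 => [x y _ _ /inj|x|x _] //.
Qed.

Section GeneratingCharacter.
Variables (R : finPzRingType) (A : finBimodType R) (F : numClosedFieldType).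

(** A character of A that is nontrivial on every nonzero right submodule, on a
    bimodule which is faithful as a left module: if chi (r a) = 1 for all a,
    then rA is a right submodule on which chi is trivial, so rA = 0. *)
Record generating (chi : A -> F) : Prop := Generating {
  gen_neq0 : forall a, chi a != 0;
  gcharD : forall a b, chi (a + b) = chi a * chi b;
  gen_right : forall a, (forall r, chi (rscale a r) = 1) -> a = 0;
  gen_faithful : forall r, (forall a, chi (lscale r a) = 1) -> r = 0
}.

(** Evaluation at 1 of the right isomorphism gives the character; the left
    isomorphism carries over the faithfulness of the left action of R on its
    characters, which separate the points of R. *)
Lemma frobenius_generating :
    left_iso A (addchar R F) -> right_iso A (addchar R F) ->
  exists chi, generating chi.
Proof.
move=> [phi [phi_bij phiD phiZ]] [psi [psi_bij psiD psiZ]].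
have psiE a r : psi (rscale a r) 1 = psi a r.
  by rewrite psiZ char_rscaleE mulr1.
have psi_right a : (forall r, psi (rscale a r) 1 = 1) -> a = 0.
  move=> a1; apply: (bij_inj psi_bij); apply: (addrI (psi 0)).
  rewrite -!psiD add0r addr0; apply: Defs.charP => r.
  have e0 : psi 0 = 0 by apply: (addrI (psi 0)); rewrite -psiD !addr0.
  by rewrite -psiE a1 e0 [RHS]mk_charE.
exists (fun a => psi a 1); split=> // [a | a b | r r1].
- exact: char_neq0.
- by rewrite psiD [LHS]mk_charE.
have ra0 (a : A) : lscale r a = 0.
  by apply: psi_right => s; rewrite -lrscaleA r1.
have [//|r0] := eqVneq r 0; have [p /eqP[]] := addchar_sep F r0.
have [psi' psi'K Kpsi'] := phi_bij.
have phi0 : phi 0 = 0 by apply: (addrI (phi 0)); rewrite -phiD !addr0.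
have <- : (lscale r p : addchar R F) 1 = p r by rewrite char_lscaleE mul1r.
by rewrite -[p]Kpsi' -phiZ ra0 phi0 [LHS]mk_charE.
Qed.

Variable chi : A -> F.
Hypothesis gen : generating chi.

Lemma gchar0 : chi 0 = 1.
Proof. by apply: (mulfI (gen_neq0 gen 0)); rewrite -(gcharD gen) addr0 mulr1. Qed.

Lemma gcharN a : chi (- a) = (chi a)^-1.
Proof.
apply: (mulfI (gen_neq0 gen a)).
by rewrite -(gcharD gen) subrr gchar0 divff // (gen_neq0 gen).
Qed.

Lemma sum_gen_right a :
  \sum_r chi (rscale a r) = if a == 0 then #|R|%:R else 0.
Proof.
case: eqP => [->|/eqP a0].
  by under eq_bigr do rewrite rscale0r gchar0; rewrite sumr_const.
have /existsP[r0 r1] : [exists r, chi (rscale a r) != 1].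
  apply: contraNT a0 => /existsPn ar; apply/eqP/(gen_right gen) => r.
  by apply/eqP; have := ar r; rewrite negbK.
apply: (sumT_twisted_eq0 (tau := +%R r0)) r1 => [|r]; first exact: addrI.
by rewrite rscaleDr (gcharD gen).
Qed.

(** Only the characters chi (_ s) occur: they already suffice to invert, because
    they separate the points of A. *)
Lemma fourier_inversion (g : A -> F) b :
  \sum_s (\sum_a g a * chi (rscale a s)) * chi (- rscale b s) = #|R|%:R * g b.
Proof.
under eq_bigr do rewrite mulr_suml.
rewrite exchange_big /=.
have step a : \sum_s g a * chi (rscale a s) * chi (- rscale b s)
               = g a * (if a - b == 0 then #|R|%:R else 0).
  rewrite -sum_gen_right mulr_sumr; apply: eq_bigr => s _.
  by rewrite -mulrA -(gcharD gen) rscaleDl rscaleNr.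
rewrite (eq_bigr _ (fun a _ => step a)) (bigD1 b) //= subrr eqxx mulrC.
rewrite big1 ?addr0 // => a ab; by rewrite subr_eq0 (negPf ab) mulr0.
Qed.

Lemma card_ring_neq0 : #|R|%:R != 0 :> F.
Proof. by rewrite pnatr_eq0 -lt0n; apply/card_gt0P; exists 0. Qed.

(** By [fourier_inversion] phi would vanish if it were orthogonal to all the
    characters chi (_ s). *)
Lemma gen_complete (phi : A -> F) :
    (forall a, phi a != 0) -> (forall a b, phi (a + b) = phi a * phi b) ->
  exists r, forall a, phi a = chi (rscale a r).
Proof.
move=> phi0 phiD.
have /existsP[s /forallP s1] : [exists s, forall a, phi a * chi (rscale a s) == 1].
  apply: contraT => /existsPn ne.
  have := fourier_inversion phi 0; rewrite big1 => [/esym/eqP|s _].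
    by rewrite mulf_eq0 (negPf card_ring_neq0) (negPf (phi0 _)).
  have /forallPn[a0 a1] := ne s.
  rewrite (sumT_twisted_eq0 (tau := +%R a0) _ _ a1) ?mul0r //.
    exact: addrI.
  by move=> a; rewrite phiD rscaleDl (gcharD gen) mulrACA.
exists (- s) => a; rewrite rscalerN gcharN; apply/eqP.
by rewrite -(inj_eq (mulIf (gen_neq0 gen (rscale a s)))) mulVf ?(gen_neq0 gen).
Qed.

(** The characters chi (r _) are pairwise distinct because A is faithful, and
    each of them is some chi (_ s) by [gen_complete]. Both families are indexed
    by R, so they coincide and the second one is free of repetitions too. *)
Lemma gen_swap_faithful s :
  (exists r, forall a, chi (lscale r a) = chi (rscale a s))
  /\ ((forall a, chi (rscale a s) = 1) -> s = 0).
Proof.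
pose L r := [ffun a => chi (lscale r a)].
pose Q r := [ffun a => chi (rscale a r)].
have injL : injective L.
  move=> r t /ffunP e; apply/eqP; rewrite -subr_eq0; apply/eqP.
  apply: (gen_faithful gen) => a; have := e a; rewrite !ffunE => ea.
  have -> : lscale (r - t) a = lscale r a - lscale t a.
    have e2 : lscale (r - t) a + lscale t a = lscale r a.
      by rewrite -lscaleDl subrK.
    by rewrite -e2 addrK.
  by rewrite (gcharD gen) gcharN ea divff ?(gen_neq0 gen).
have LQ : {subset [seq L r | r : R] <= [seq Q r | r : R]}.
  move=> _ /mapP[r _ ->].
  have [||t et] := @gen_complete (fun a => chi (lscale r a)).
  - by move=> a; exact: gen_neq0.
  - by move=> a b; rewrite lscaleDr (gcharD gen).
  apply/mapP; exists t; first by rewrite mem_enum.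
  by apply/ffunP=> a; rewrite !ffunE.
have Luniq : uniq [seq L r | r : R].
  by rewrite map_inj_uniq ?enum_uniq.
have leQL : (size [seq Q r | r : R] <= size [seq L r | r : R])%N.
  by rewrite !size_map.
split.
  have [_ eLQ] := uniq_min_size Luniq LQ leQL.
  have /mapP[r _ /ffunP er] : Q s \in [seq L r | r : R].
    by rewrite eLQ; apply: map_f; rewrite mem_enum.
  by exists r => a; have := er a; rewrite !ffunE.
have /injectiveP injQ : injectiveb Q by exact: leq_size_uniq Luniq LQ leQL.
move=> s1; apply: injQ; apply/ffunP=> a.
by rewrite !ffunE s1 rscaler0 gchar0.
Qed.

Lemma gen_swap s : exists r, forall a, chi (lscale r a) = chi (rscale a s).
Proof. by case: (gen_swap_faithful s). Qed.

Lemma gen_right_faithful s : (forall a, chi (rscale a s) = 1) -> s = 0.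
Proof. by case: (gen_swap_faithful s). Qed.

(** If chi is trivial on Ra, then [gen_swap] makes it trivial on aR. *)
Lemma gen_left a : (forall r, chi (lscale r a) = 1) -> a = 0.
Proof.
move=> a1; apply: (gen_right gen) => s.
by have [r <-] := gen_swap s.
Qed.

Lemma gen_leftP a : a != 0 -> exists r, chi (lscale r a) != 1.
Proof.
move=> a0; apply/existsP; apply: contraNT a0 => /existsPn ar.
by apply/eqP/gen_left => r; apply/eqP; have := ar r; rewrite negbK.
Qed.

Definition gen_sum (X : {set A}) : F := \sum_(a | rcyclic a == X) chi a.

Lemma mem_rcyclic (a : A) : a \in rcyclic a.
Proof. by apply/imsetP; exists 1; rewrite ?rscale1. Qed.

Lemma rcyclic_sub S (a : A) : right_submodule S -> (rcyclic a \subset S) = (a \in S).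
Proof.
case=> _ _ SM; apply/subsetP/idP => [|Sa x /imsetP[s _ ->]]; last exact: SM.
by apply; exact: mem_rcyclic.
Qed.

Lemma rcyclic_submodule (a : A) : right_submodule (rcyclic a).
Proof.
split; first by apply/imsetP; exists 0; rewrite ?rscaler0.
  by move=> _ _ /imsetP[s _ ->] /imsetP[t _ ->]; rewrite -rscaleDr imset_f.
by move=> t _ /imsetP[s _ ->]; rewrite rscaleA imset_f.
Qed.

Lemma rcyclic0 : rcyclic (0 : A) = [set 0].
Proof.
apply/setP=> a; rewrite inE; apply/imsetP/eqP => [[r _ ->]|->].
  exact: rscale0r.
by exists 0; rewrite ?rscale0r.
Qed.

Lemma sum_by_rcyclic (S : {set A}) (g : A -> F) : right_submodule S ->
  \sum_(X in rcyclics A | X \subset S) \sum_(a | rcyclic a == X) g a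
   = \sum_(a in S) g a.
Proof.
move=> subS; rewrite [RHS](partition_big (@rcyclic _ A)
  (fun X => (X \in rcyclics A) && (X \subset S))) /=.
  apply: eq_bigr => X /andP[_ sX]; apply: eq_bigl => a.
  by case: eqP => [e|]; rewrite ?andbF // -rcyclic_sub // e sX.
by move=> a Sa; rewrite rcyclic_sub // Sa andbT imset_f.
Qed.

Lemma sum_gen_submodule S : right_submodule S -> S != [set 0] ->
  \sum_(a in S) chi a = 0.
Proof.
move=> subS S0; have [S00 SD SM] := subS.
have /existsP[a /andP[Sa a0]] : [exists a, (a \in S) && (a != 0)].
  apply: contraNT S0 => /existsPn aS; apply/eqP/setP=> a; rewrite inE.
  apply/idP/eqP => [Sa|-> //]; apply/eqP.
  by have := aS a; rewrite Sa /= negbK.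
have /existsP[r r1] : [exists r, chi (rscale a r) != 1].
  apply: contraNT a0 => /existsPn ar; apply/eqP/(gen_right gen) => r.
  by apply/eqP; have := ar r; rewrite negbK.
apply: (sum_twisted_eq0 (tau := +%R (rscale a r))) r1 => [x y _ _ /addrI|x Sx|x _] //.
  by rewrite SD ?SM.
by rewrite (gcharD gen).
Qed.

(** The recursion defining the Moebius function on the X other than 0 holds for
    [gen_sum] because a nontrivial character sums to 0 over X. *)
Lemma moebius_gen (X : {set A}) : X \in rcyclics A ->
  (moebius (rcyclics A) [set 0] X)%:~R = gen_sum X.
Proof.
have [n] := ubnP #|X|; elim: n X => // n IHn X leX PX.
have [a _ eX] := imsetP PX.
have subX : right_submodule X by rewrite eX; exact: rcyclic_submodule.
have zX : [set 0] \subset X by rewrite sub1set; case: subX.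
have [->|neX] := eqVneq X [set 0].
  rewrite moebius_refl /gen_sum (big_pred1 0) ?gchar0 // => b /=.
  apply/eqP/eqP => [e|->]; last exact: rcyclic0.
  by have := mem_rcyclic b; rewrite e inE => /eqP.
have ltX : [set 0] \proper X by rewrite properEneq eq_sym neX.
have := moebius_sum PX ltX.
rewrite (bigD1 X) /=; last by rewrite PX zX subxx.
move/(congr1 (fun z : int => z%:~R : F)); rewrite rmorphD rmorph_sum /=.
rewrite (eq_bigr gen_sum); last first.
  move=> Z /andP[/and3P[PZ _ sZ] neZ]; apply: IHn => //.
  rewrite -ltnS; apply: leq_trans leX; rewrite ltnS.
  by apply: proper_card; rewrite properEneq neZ.
move/eqP; rewrite mulr0z addr_eq0 => /eqP->.
have := sum_gen_submodule subX neX.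
rewrite -(sum_by_rcyclic _ subX) (bigD1 X) /=; last by rewrite PX subxx.
move/eqP; rewrite addr_eq0 -/(gen_sum X) => /eqP->; congr (- _).
apply: eq_bigl => Z; case PZ: (Z \in rcyclics A) => //=.
have [b _ ->] := imsetP PZ.
by rewrite sub1set; case: (rcyclic_submodule b) => ->.
Qed.

End GeneratingCharacter.

(** * Fourier coefficients of the weight *)

Section Weight.
Variables (R : finPzRingType) (A : finBimodType R) (F : numClosedFieldType).
Variable chi : A -> F.
Hypothesis gen : generating chi.
Variable w : A -> F.
Hypothesis wU : forall u a, u \in runits R -> w (rscale a u) = w a.

Lemma cyclic_weightE (a : A) : cyclic_weight w (rcyclic a) = w a.
Proof.
rewrite /cyclic_weight; case: pickP => [b /eqP/right_associates[u Uu ->]|no].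
  by rewrite wU.
by have := no a; rewrite eqxx.
Qed.

Lemma moebius_weight (S : {set A}) : right_submodule S ->
  \sum_(X in rcyclics A | X \subset S)
     cyclic_weight w X * (moebius (rcyclics A) [set 0] X)%:~R
  = \sum_(a in S) w a * chi a.
Proof.
move=> subS; rewrite -(sum_by_rcyclic _ subS).
apply: eq_bigr => X /andP[PX _].
rewrite (moebius_gen gen PX) mulr_sumr; apply: eq_bigr => a /eqP<-.
by rewrite cyclic_weightE.
Qed.

(** Up to the factor #|R|, the coefficient of the character chi (_ s) in the
    Fourier expansion of w; the sign usual in that expansion disappears because
    w (- a) = w a. *)
Definition wcoef (s : R) : F := \sum_a w a * chi (rscale a s).

Lemma wcoefU u s : u \in runits R -> wcoef (u * s) = wcoef s.
Proof.
move=> Uu; rewrite /wcoef [RHS](reindex_inj (rscale_unit_inj Uu)) /=.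
by apply: eq_bigr => a _; rewrite wU // rscaleA.
Qed.

Lemma wcoef_inversion b : \sum_s wcoef s * chi (rscale b s) = #|R|%:R * w b.
Proof.
have wN : w (- b) = w b.
  by rewrite -[in RHS](wU b (runitsN1 R)) rscalerN rscale1.
rewrite -wN -(fourier_inversion gen); apply: eq_bigr => s _.
by rewrite rscaleNr opprK.
Qed.

Hypothesis w_neq0 : forall S : {set A}, right_submodule S -> S != [set 0] ->
  \sum_(a in S) w a * chi a != 0.

(** The s with s r = r form the coset 1 + L of the left annihilator L of r.
    Summing chi (a _) over it gives #|L| chi a if a lies in the right submodule
    S orthogonal to L, and 0 otherwise, so the sum is #|L| times the sum of
    w a * chi a over S. If chi (q _) = chi (_ r), then S contains qA, which is
    nonzero when r is. *)
Lemma sum_wcoef_neq0 r : r != 0 -> \sum_(s | s * r == r) wcoef s != 0.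
Proof.
move=> r0; pose L := [set s | s * r == 0].
pose S : {set A} := [set a | [forall s in L, chi (rscale a s) == 1]].
have SP a : reflect (forall s, s * r = 0 -> chi (rscale a s) = 1) (a \in S).
  rewrite inE; apply: (iffP forall_inP) => h s.
    by move=> sr; apply/eqP/h; rewrite inE sr.
  by rewrite inE => /eqP sr; apply/eqP/h.
have subS : right_submodule S.
  split=> [|a b /SP Sa /SP Sb|t a /SP Sa]; apply/SP=> s sr.
  - by rewrite rscale0r (gchar0 gen).
  - by rewrite rscaleDl (gcharD gen) Sa // Sb // mulr1.
  by rewrite rscaleA Sa // -mulrA sr mulr0.
have S0 : S != [set 0].
  have [q eq] := gen_swap gen r.
  have qa a : lscale q a \in S.
    by apply/SP=> s sr; rewrite -lrscaleA eq rscaleA sr rscaler0 (gchar0 gen).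
  have [a a1] : exists a, chi (rscale a r) != 1.
    apply/existsP; apply: contraNT r0 => /existsPn a1; apply/eqP.
    apply: (gen_right_faithful gen) => a.
    by apply/eqP; have := a1 a; rewrite negbK.
  apply: contraNneq a1 => eS; have := qa a; rewrite eS inE -eq => /eqP->.
  by rewrite (gchar0 gen).
have L_gt0 : (0 < #|L|)%N by apply/card_gt0P; exists 0; rewrite inE mul0r.
suff -> : \sum_(s | s * r == r) wcoef s = #|L|%:R * (\sum_(a in S) w a * chi a).
  by rewrite mulf_neq0 ?w_neq0 // pnatr_eq0 -lt0n.
rewrite /wcoef exchange_big /= mulr_sumr.
rewrite (bigID (mem S)) /= [X in _ + X]big1 ?addr0 => [|a aS].
  apply: eq_bigr => a /SP Sa.
  transitivity (\sum_(s | s * r == r) w a * chi a).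
    apply: eq_bigr => s /eqP sr; congr (_ * _).
    rewrite -[s](subrK 1) rscaleDr (gcharD gen) rscale1 Sa ?mul1r //.
    by rewrite mulrBl mul1r sr subrr.
  rewrite sumr_const mulr_natl; congr (_ *+ _).
  rewrite -(card_imset L (addrI 1)); apply: eq_card => s.
  rewrite -topredE /=; apply/eqP/imsetP => [sr | [t + ->]].
    by exists (s - 1); rewrite ?inE ?mulrBl ?mul1r ?sr ?subrr // addrC subrK.
  by rewrite inE => /eqP tr; rewrite mulrDl mul1r tr addr0.
have /forallPn[s] : ~~ [forall s in L, chi (rscale a s) == 1].
  by apply: contraNN aS; rewrite inE.
rewrite negb_imply inE => /andP[/eqP sr s1]; rewrite -mulr_sumr.
apply/eqP; rewrite mulf_eq0; apply/orP; right; apply/eqP.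
transitivity (\sum_(t in [set t | t * r == r]) chi (rscale a t)).
  by apply: eq_bigl => t; rewrite inE.
apply: (sum_twisted_eq0 (tau := +%R s)) s1 => [x y _ _ /addrI //|x|x _].
  by rewrite !inE mulrDl sr add0r.
by rewrite rscaleDr (gcharD gen).
Qed.

(** The unknowns d(t) of the linear system are differences of these sums.
    Summing over the units makes them invariant under left multiplication of t
    by units. *)
Definition orbit_char n (x : {ffun 'I_n -> A}) (t : R) : F :=
  \sum_i \sum_(u in runits R) chi (rscale (rscale (x i) u) t).

Lemma orbit_charU n (x : {ffun 'I_n -> A}) u t : u \in runits R ->
  orbit_char x (u * t) = orbit_char x t.
Proof.
move=> Uu; apply: eq_bigr => i _.
rewrite -[RHS](sum_runitsMr _ Uu); apply: eq_bigr => v _.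
by rewrite !rscaleA mulrA.
Qed.

(** Expand w (q x_i u) in the characters chi (_ s); the hypothesis turns
    chi (q x_i u s) into chi (x_i u s t). *)
Lemma wt_orbit_char n (x : {ffun 'I_n -> A}) q t :
    (forall a, chi (lscale q a) = chi (rscale a t)) ->
  \sum_s wcoef s * orbit_char x (s * t)
    = (#|R| * #|runits R|)%:R * wt w (lscale_vec q x).
Proof.
move=> qt; under eq_bigr do rewrite mulr_sumr.
rewrite exchange_big mulr_sumr; apply: eq_bigr => i _ /=.
under eq_bigr do rewrite mulr_sumr.
rewrite exchange_big natrM mulrAC mulr_natr -sumr_const /=; apply: eq_bigr => u Uu.
rewrite ffunE -(wU _ Uu) -wcoef_inversion; apply: eq_bigr => s _.
by rewrite -rscaleA -qt !lrscaleA.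
Qed.

(** Induction on the left ideal R t. In the sum of wcoef s * d (s * t) = 0 the
    terms with R s t smaller than R t vanish by induction; in all others s * t
    is a unit multiple of t, so they add up to d t times a nonzero factor. *)
Lemma eq_orbit_char n (x y : {ffun 'I_n -> A}) :
    (forall q, wt w (lscale_vec q x) = wt w (lscale_vec q y)) ->
  forall t, orbit_char x t = orbit_char y t.
Proof.
move=> xy t; pose lideal (r : R) : {set R} := [set s * r | s : R].
have lidealP r s : reflect (exists q, s = q * r) (s \in lideal r).
  by apply: (iffP imsetP) => [[q _ ->]|[q ->]]; exists q.
have [m] := ubnP #|lideal t|; elim: m t => // m IHm t letm.
have [->|t0] := eqVneq t 0.
  apply: eq_bigr => i _; apply: eq_bigr => u _.
  by rewrite !rscaler0.
pose d r := orbit_char x r - orbit_char y r.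
have dU u r : u \in runits R -> d (u * r) = d r.
  by move=> Uu; rewrite /d !orbit_charU.
apply/eqP; rewrite -subr_eq0 -/(d t).
have sum_d : \sum_s wcoef s * d (s * t) = 0.
  have [q qt] := gen_swap gen t.
  under eq_bigr do rewrite mulrBr.
  by rewrite sumrB !(wt_orbit_char _ qt) xy subrr.
(* the generators of the left ideal R t *)
pose G := [set r in lideal t | t \in lideal r].
have GU r : r \in G -> exists2 u, u \in runits R & r = u * t.
  rewrite inE => /andP[/lidealP[q rq] /lidealP[q' tq']].
  exact: left_associates rq tq'.
have sum_G : \sum_(s | s * t \in G) wcoef s = #|G|%:R * \sum_(s | s * t == t) wcoef s.
  rewrite (partition_big (fun s => s * t) (mem G)) //= mulr_natl -sumr_const.
  apply: eq_bigr => r Gr; have [u Uu ru] := GU r Gr.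
  rewrite (reindex_inj (runit_injl Uu)) /=; apply: eq_big => [s|s _].
    rewrite -mulrA ru (inj_eq (runit_injl Uu)); case: eqP => [->|]; last by rewrite andbF.
    by rewrite -ru Gr.
  exact: wcoefU.
have : (\sum_(s | s * t \in G) wcoef s) * d t = 0.
  rewrite -[RHS]sum_d [RHS](bigID (fun s => s * t \in G)) /= [X in _ = _ + X]big1 => [|s nG].
    rewrite addr0 mulr_suml; apply: eq_bigr => s /GU[u Uu ->].
    by rewrite dU.
  rewrite [d _](_ : _ = 0) ?mulr0 //; apply/eqP; rewrite subr_eq0; apply/eqP.
  apply: IHm; rewrite -ltnS; apply: leq_trans letm; rewrite ltnS.
  apply: proper_card; apply/properP; split.
    apply/subsetP=> r /lidealP[q ->]; apply/lidealP; exists (q * s).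
    by rewrite mulrA.
  exists t; first by apply/lidealP; exists 1; rewrite mul1r.
  apply: contraNN nG => tst; rewrite inE tst andbT.
  by apply/lidealP; exists s.
move/eqP; rewrite mulf_eq0 sum_G mulf_eq0 (negPf (sum_wcoef_neq0 t0)) orbF.
case/orP=> //; rewrite pnatr_eq0 cards_eq0 => /eqP G0.
have : t \in G.
  by rewrite inE; apply/andP; split; apply/lidealP; exists 1; rewrite mul1r.
by rewrite G0 inE.
Qed.

End Weight.

(** * Comparing the coordinates of a code and of its image *)

Section Extension.
Variables (R : finPzRingType) (A : finBimodType R) (F : numClosedFieldType).
Variable chi : A -> F.
Hypothesis gen : generating chi.
Variables (n : nat) (code : {set {ffun 'I_n -> A}}).
Hypothesis codeP : is_code code.

Local Notation V := {ffun 'I_n -> A}.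

(** Left linear maps from the code to A, extended by 0 outside of the code so
    that maps with the same values on the code are equal. *)
Record linear_on (h : {ffun V -> A}) : Prop := LinearOn {
  linD : {in code &, {morph h : x y / x + y}};
  linZ : forall r, {in code, forall x, h (lscale_vec r x) = lscale r (h x)};
  lin0 : forall x, x \notin code -> h x = 0
}.

Definition restr (f : V -> V) (i : 'I_n) : {ffun V -> A} :=
  [ffun x => if x \in code then f x i else 0].

Lemma restr_linear f i : {in code &, {morph f : x y / x + y}} ->
  (forall r, {in code, {morph f : x / lscale_vec r x}}) -> linear_on (restr f i).
Proof.
case: codeP => _ CD CZ fD fZ; split=> [x y Cx Cy | r x Cx | x /negPf Cx].
- by rewrite !ffunE Cx Cy CD // fD // ffunE.
- by rewrite !ffunE Cx CZ // fZ // ffunE.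
by rewrite ffunE Cx.
Qed.

Definition ract (h : {ffun V -> A}) (u : R) : {ffun V -> A} :=
  [ffun x => rscale (h x) u].

Lemma ractM h u v : ract (ract h u) v = ract h (u * v).
Proof. by apply/ffunP=> x; rewrite !ffunE rscaleA. Qed.

Lemma ract1 h : ract h 1 = h.
Proof. by apply/ffunP=> x; rewrite !ffunE rscale1. Qed.

Lemma ract_linear h u : linear_on h -> linear_on (ract h u).
Proof.
move=> linh; split=> [x y Cx Cy | r x Cx | x Cx]; rewrite !ffunE.
- by rewrite (linD linh) // rscaleDl.
- by rewrite (linZ linh) // lrscaleA.
by rewrite (lin0 linh) // rscale0r.
Qed.

(** If g x0 <> h x0, then chi is nontrivial on the left submodule generated by
    g x0 - h x0, which consists of values of g - h. *)
Lemma linear_orthogonality g h : linear_on g -> linear_on h ->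
  \sum_(x in code) chi (g x) * chi (- h x) = (#|code| * (g == h))%:R.
Proof.
move=> ling linh; case: eqVneq => [->|ne].
  rewrite muln1 -sumr_const; apply: eq_bigr => x _.
  by rewrite -(gcharD gen) subrr (gchar0 gen).
rewrite muln0; have /existsP[x0 x0gh] : [exists x, g x != h x].
  apply: contraNT ne => /existsPn gh; apply/eqP/ffunP=> x.
  by apply/eqP; have := gh x; rewrite negbK.
have Cx0 : x0 \in code.
  by apply: contraNT x0gh => nC; rewrite (lin0 ling) ?(lin0 linh).
have [r r1] : exists r, chi (lscale r (g x0 - h x0)) != 1.
  by apply: (gen_leftP gen); rewrite subr_eq0.
case: codeP => _ CD CZ.
have Crx0 := CZ r _ Cx0.
apply: (sum_twisted_eq0 (tau := +%R (lscale_vec r x0))) r1 => [x y _ _ /addrI //|x Cx|x Cx].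
  exact: CD.
rewrite (linD ling) // (linD linh) // (linZ ling) // (linZ linh) //.
by rewrite lscaleDr lscalerN opprD !(gcharD gen) mulrACA.
Qed.

Definition orb (h : {ffun V -> A}) : {set {ffun V -> A}} :=
  [set ract h u | u in runits R].

Lemma orb_refl h : h \in orb h.
Proof. by apply/imsetP; exists 1; rewrite ?runits1 ?ract1. Qed.

Lemma orb_ract h u : u \in runits R -> orb (ract h u) = orb h.
Proof.
move=> Uu; have [v Uv [uv _]] := runitsV Uu.
apply/setP=> k; apply/imsetP/imsetP=> [[t Ut ->]|[t Ut ->]].
  by exists (u * t); rewrite ?runitsM ?ractM.
by exists (v * t); rewrite ?runitsM ?ractM // mulrA uv mul1r.
Qed.

Lemma mem_orb h k u : u \in runits R -> (ract h u \in orb k) = (orb h == orb k).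
Proof.
move=> Uu; apply/imsetP/eqP => [[v Uv e]|e].
  by rewrite -(orb_ract h Uu) e orb_ract.
by apply/imsetP; rewrite -/(orb k) -e; apply/imsetP; exists u.
Qed.

(** Double counting of the pairs of an index i and a unit u that take c i into
    the orbit of k. *)
Lemma count_orb (c : 'I_n -> {ffun V -> A}) k :
  (#|[pred i | orb (c i) == orb k]| * #|runits R|
   = \sum_(h in orb k) \sum_i \sum_(u in runits R) (ract (c i) u == h))%N.
Proof.
rewrite exchange_big /= -sum1_card big_distrl /= [LHS]big_mkcond /=.
apply: eq_bigr => i _; rewrite exchange_big /=.
transitivity (\sum_(u in runits R) (orb (c i) == orb k : nat))%N.
  by rewrite sum_nat_const inE; case: ifP; rewrite ?mul1n ?muln1 ?muln0.
apply: eq_bigr => u Uu; rewrite -(mem_orb _ _ Uu).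
have [kc|kc] := boolP (ract (c i) u \in orb k).
  rewrite (bigD1 _ kc) /= eqxx big1 // => h /andP[_].
  by rewrite eq_sym => /negPf->.
by rewrite big1 // => h kh; case: eqP => // e; rewrite e kh in kc.
Qed.

(** By [linear_orthogonality], summing against chi (- h) over the code gives
    #|code| times the number of pairs (i, u) with c i u = h. So c and c' meet
    each orbit of the units equally often. *)
Lemma orbits_perm (c c' : 'I_n -> {ffun V -> A}) :
    (forall i, linear_on (c i)) -> (forall i, linear_on (c' i)) ->
    {in code, forall x, \sum_i \sum_(u in runits R) chi (rscale (c i x) u)
                      = \sum_i \sum_(u in runits R) chi (rscale (c' i x) u)} ->
  exists s : 'S_n, forall i, orb (c' i) = orb (c (s i)).
Proof.
move=> linc linc' ecc'.
have code_gt0 : (0 < #|code|)%N by apply/card_gt0P; exists 0; case: codeP.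
have U_gt0 : (0 < #|runits R|)%N by apply/card_gt0P; exists 1; exact: runits1.
have countE (b : 'I_n -> {ffun V -> A}) h :
    (forall i, linear_on (b i)) -> linear_on h ->
  (#|code| * \sum_i \sum_(u in runits R) (ract (b i) u == h))%:R =
  \sum_(x in code) (\sum_i \sum_(u in runits R) chi (rscale (b i x) u)) * chi (- h x).
  move=> linb linh; under [RHS]eq_bigr do rewrite mulr_suml.
  rewrite [RHS]exchange_big big_distrr natr_sum /=; apply: eq_bigr => i _.
  under [RHS]eq_bigr do rewrite mulr_suml.
  rewrite [RHS]exchange_big big_distrr natr_sum /=; apply: eq_bigr => u Uu.
  rewrite -linear_orthogonality //; last exact: ract_linear.
  by apply: eq_bigr => x _; rewrite ffunE.
have count_cc' k : linear_on k ->
    #|[pred i | orb (c i) == orb k]| = #|[pred i | orb (c' i) == orb k]|.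
  move=> link; apply/eqP; rewrite -(eqn_pmul2r U_gt0) !count_orb; apply/eqP.
  apply: eq_bigr => _ /imsetP[u Uu ->]; have := ract_linear u link.
  move: (ract k u) => h linh; apply/eqP; rewrite -(eqn_pmul2l code_gt0).
  rewrite -(eqr_nat F) !countE //; apply/eqP/eq_bigr => x Cx.
  by rewrite ecc'.
have /tuple_permP[s es] : perm_eq [tuple orb (c' i) | i < n] [tuple orb (c i) | i < n].
  apply/allP=> X; rewrite mem_cat => XX.
  have [k link ->] : exists2 k, linear_on k & X = orb k.
    by case/orP: XX => /mapP[i _ ->]; [exists (c' i) | exists (c i)].
  have cnt (b : 'I_n -> {ffun V -> A}) :
      count_mem (orb k) [tuple orb (b i) | i < n] = #|[pred i | orb (b i) == orb k]|.
    by rewrite count_map -size_filter cardE /enum_mem -enumT.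
  by rewrite /= !cnt count_cc'.
exists s => i; have := congr1 (fun t => nth set0 t i) es.
by rewrite -!tnth_nth !tnth_mktuple.
Qed.

End Extension.

Theorem theorem4p4 (K : realType) (R : finPzRingType) (A : finBimodType R)
    (w : A -> K[i]) :
  frobenius_bimodule K A ->
  is_weight w ->
  bi_invariant w ->
  (forall S : {set A}, right_submodule S -> S != [set 0] ->
     \sum_(X in rcyclics A | X \subset S)
        cyclic_weight w X * (moebius (rcyclics A) [set 0] X)%:~R != 0) ->
  extension_property w.
Proof.
move=> [lA rA] _ wUU w_neq0 n code codeP f [_ fD fZ fw].
have [chi gen] := frobenius_generating lA rA.
have wU u a : u \in runits R -> w (rscale a u) = w a.
  move=> /runitsP Uu; rewrite -[in LHS](lscale1 a) wUU //.
  by exists 1; rewrite mulr1.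
have sum_neq0 (S : {set A}) : right_submodule S -> S != [set 0] ->
    \sum_(a in S) w a * chi a != 0.
  by move=> subS S0; rewrite -(moebius_weight gen wU subS) w_neq0.
have [_ _ CZ] := codeP.
have lin_id i : linear_on code (restr code id i) by exact: restr_linear.
have lin_f i : linear_on code (restr code f i) by exact: restr_linear.
have [|s es] := orbits_perm gen codeP lin_id lin_f.
  move=> x Cx.
  have wtx q : wt w (lscale_vec q x) = wt w (lscale_vec q (f x)).
    by rewrite -fZ // fw // CZ.
  have := eq_orbit_char gen wU sum_neq0 wtx 1; rewrite /orbit_char.
  move=> e; transitivity (orbit_char chi x 1).
    apply: eq_bigr => i _; apply: eq_bigr => u _.
    by rewrite ffunE Cx rscale1.
  rewrite [LHS]e; apply: eq_bigr => i _; apply: eq_bigr => u _.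
  by rewrite ffunE Cx rscale1.
have exu i : exists2 u, u \in runits R
    & restr code f i = ract (restr code id (s i)) u.
  have /imsetP[u Uu e] : restr code f i \in orb (restr code id (s i)).
    by rewrite -es orb_refl.
  by exists u.
have [u Uu fu] := fin_all_exists2 exu.
exists (fun x => [ffun i => rscale (x (s i)) (u i)]).
  by exists s, u; split=> // i; apply/runitsP.
move=> x Cx; apply/ffunP=> i; have /ffunP/(_ x) := fu i.
by rewrite !ffunE Cx.
Qed.
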